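(* Let $m\ge 1$ and let $\sigma=(\sigma_0,\dots,\sigma_m)$ be an alternating sequence of signs. In the space of all stunted sawtooth maps of shape $\sigma$ (identified with the space $V_\sigma\subset\mathbb R^m$ of their folding value vectors), the maps which are strictly $m$-modal and hyperbolic form a dense open set.
   Context: $\sigma_j\in\{\pm1\}$ with $\sigma_{j}=(-1)^j\sigma_0$. Stunted sawtooth maps: put $s=m+\tfrac32$, $\alpha=\frac{ms}{s-1}$ (so $m<\alpha<m+1$), $J=[-\alpha,\alpha]$, $\widehat C_j=2j-m-1$ for $1\le j\le m$ and $\widehat I_j=2j-m$ for $0\le j\le m$. The sawtooth map $S:J\to\mathbb R$ is the continuous piecewise linear map with $S(y)=\sigma_j s\,(y-\widehat I_j)$ for $y\in J$, $|y-\widehat I_j|\le 1$, $0\le j\le m$. Let $V_\sigma$ be the set of $\mathbf v=(v_1,\dots,v_m)\in J^m$ such that for $0<j<m$: $v_j\le v_{j+1}$ if $\sigma_j=+1$, and $v_j\ge v_{j+1}$ if $\sigma_j=-1$. For $\mathbf v\in V_\sigma$ the stunted sawtooth map $S_{\mathbf v}:J\to J$ with folding values $v_1,\dots,v_m$ is defined by $S_{\mathbf v}(y)=v_j$ if $|y-\widehat C_j|\le 1+\sigma_jv_j/s$ for some $1\le j\le m$, and $S_{\mathbf v}(y)=S(y)$ otherwise. The interval $\{y\in J: |y-\widehat C_j|\le 1+\sigma_jv_j/s\}$ is the $j$-th plateau of $S_{\mathbf v}$. With $v_0=S_{\mathbf v}(-\alpha)$ and $v_{m+1}=S_{\mathbf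 v}(\alpha)$, the map is strictly $m$-modal if $\sigma_j(v_{j+1}-v_j)>0$ for all $0\le j\le m$. A strictly $m$-modal stunted sawtooth map is hyperbolic if the forward orbit $\{S_{\mathbf v}^{\circ k}(v_i):k\ge0\}$ of each folding value $v_i$, $1\le i\le m$, meets the interior of some plateau. *)

(* Defs.v *)
From HB Require Import structures.
From mathcomp Require Import all_boot all_order all_algebra.
From mathcomp Require Import all_classical all_reals all_analysis.
From mathcomp Require Import ring lra.
Import Order.TTheory GRing.Theory Num.Theory.
Import numFieldNormedType.Exports.

Set Implicit Arguments.
Unset Strict Implicit.
Unset Printing Implicit Defensive.

Local Open Scope classical_set_scope.
Local Open Scope ring_scope.

Section StuntedSawtooth.
Variables (R : realType) (m : nat).

Definition alternating_signs (sigma : 'I_m.+1 -> R) : Prop :=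
  (forall j, sigma j = 1 \/ sigma j = -1) /\
  (forall j : 'I_m.+1, sigma j = (-1) ^+ j * sigma ord0).

Definition slope : R := m%:R + 3 / 2.
Definition alpha : R := m%:R * slope / (slope - 1).
Definition J : set R := `[- alpha, alpha]%classic.

(* The m turning points, plateaus and folding values are numbered from 1 in
   the mathematics and by 'I_m (from 0) here, so [i : 'I_m] stands for the
   number i + 1; the corresponding sign is [sigma (lift ord0 i)].  The m + 1
   laps and their signs are numbered from 0 on both sides. *)
Definition turning_pt (i : 'I_m) : R := 2 * i.+1%:R - m%:R - 1.
Definition lap_center (j : 'I_m.+1) : R := 2 * j%:R - m%:R.

Implicit Types (sigma : 'I_m.+1 -> R) (v : 'rV[R]_m).

(* Neighbouring laps overlap in one point, where the two formulas agree
   (sawtoothE), so it does not matter which lap is picked.  The laps cover J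
   (lap_cover), so the value 0 is only taken outside J. *)
Definition sawtooth sigma (y : R) : R :=
  if [pick j : 'I_m.+1 | `|y - lap_center j| <= 1] is Some j
  then sigma j * slope * (y - lap_center j) else 0.

Definition folding_space sigma : set 'rV[R]_m :=
  [set v | (forall i : 'I_m, J (v ord0 i)) /\
    (forall i i' : 'I_m, i' = i.+1 :> nat ->
       (sigma (lift ord0 i) = 1 -> v ord0 i <= v ord0 i') /\
       (sigma (lift ord0 i) = -1 -> v ord0 i' <= v ord0 i))].

Definition in_plateau sigma v (i : 'I_m) (y : R) : bool :=
  `|y - turning_pt i| <= 1 + sigma (lift ord0 i) * v ord0 i / slope.

Definition plateau sigma v (i : 'I_m) : set R :=
  [set y | J y /\ in_plateau sigma v i y].

(* Two plateaus that meet have the same height when v is in folding_space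
   (stuntedE), so it does not matter which one is picked.  The map is total on R;
   it sends J into J (stunted_J), and only its values on J are ever used. *)
Definition stunted sigma v (y : R) : R :=
  if [pick i : 'I_m | in_plateau sigma v i y] is Some i
  then v ord0 i else sawtooth sigma y.

(* v_0, v_1, ..., v_m, v_{m+1}, where v_0 and v_{m+1} are the values at the
   endpoints of J. *)
Definition extended_folding sigma v (j : nat) : R :=
  if j is i.+1 then
    if insub i is Some i' then v ord0 (i' : 'I_m) else stunted sigma v alpha
  else stunted sigma v (- alpha).

Definition strictly_modal sigma v : Prop :=
  forall j : 'I_m.+1,
    0 < sigma j * (extended_folding sigma v j.+1 - extended_folding sigma v j).

Definition hyperbolic sigma v : Prop :=
  forall i : 'I_m, exists (k : nat) (j : 'I_m),
    (plateau sigma v j)° (iter k (stunted sigma v) (v ord0 i)).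

Lemma slope_gt1 : 1 < slope.
Proof. by rewrite /slope; have := ler0n R m; lra. Qed.

Lemma alpha_bounds : (0 < m)%N -> m%:R < alpha < m%:R + 1.
Proof.
move=> m0; have m1 : 0 < m%:R :> R by rewrite ltr0n.
have s1 := slope_gt1; have s0 : 0 < slope - 1 by lra.
rewrite /alpha ltr_pdivlMr // ltr_pdivrMr // /slope; apply/andP; split; nra.
Qed.

Lemma J_norm (y : R) : J y = (`|y| <= alpha).
Proof. by rewrite /J /= in_itv /= ler_norml. Qed.

Lemma sawtoothE sigma (j : 'I_m.+1) (y : R) : alternating_signs sigma ->
  `|y - lap_center j| <= 1 ->
  sawtooth sigma y = sigma j * slope * (y - lap_center j).
Proof.
move=> [_ alt]; rewrite /sawtooth; case: pickP => [j' + |/(_ j)->//].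
wlog: j j' / (j' <= j)%N.
  move=> H; have [/H//|/ltnW/H{}H] := leqP j' j.
  by move=> h h'; rewrite H.
rewrite leq_eqVlt => /orP[/eqP/val_inj->//|]; rewrite leq_eqVlt => /orP[/eqP e|lt].
  rewrite (alt j) (alt j') /lap_center -e exprS !ler_norml -natr1.
  move=> /andP[a b] /andP[c d].
  have -> : y = 2 * j'%:R - m%:R + 1 by lra.
  ring.
rewrite /lap_center !ler_norml => /andP[a b] /andP[c d]; exfalso.
have : j'%:R + 2 <= j%:R :> R by rewrite -natrD ler_nat addn2.
lra.
Qed.

Lemma stuntedE sigma v (i : 'I_m) (y : R) : alternating_signs sigma ->
  folding_space sigma v -> in_plateau sigma v i y ->
  stunted sigma v y = v ord0 i.
Proof.
move=> alt [vJ vle]; rewrite /stunted; case: pickP => [i' + |/(_ i)->//].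
wlog: i i' / (i' <= i)%N.
  move=> H; have [/H//|/ltnW/H{}H] := leqP i' i.
  by move=> h h'; rewrite H.
have [_ am] := andP (alpha_bounds (leq_ltn_trans (leq0n i) (ltn_ord i))).
have s0 : 0 < slope by have := slope_gt1; lra.
have as1 : alpha < slope by rewrite /slope; lra.
rewrite leq_eqVlt => /orP[/eqP/val_inj->//|].
have bnd k : `|sigma (lift ord0 k) * v ord0 k / slope| < 1.
  have : `|v ord0 k| <= alpha by rewrite -J_norm.
  rewrite 2!normrM normfV (gtr0_norm s0) ltr_pdivrMr // mul1r => h.
  have -> : `|sigma (lift ord0 k)| = 1.
    by case: (alt.1 (lift ord0 k)) => ->; rewrite ?normrN normr1.
  by rewrite mul1r; lra.
have := bnd i; have := bnd i'.
rewrite /in_plateau /turning_pt leq_eqVlt => + + /orP[/eqP e|lt].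
  move=> _ _; rewrite !ler_norml -e.
  have sE : sigma (lift ord0 i) = - sigma (lift ord0 i').
    rewrite (alt.2 (lift ord0 i)) (alt.2 (lift ord0 i')) !lift0 -e.
    by rewrite [in LHS]exprS mulN1r mulNr.
  rewrite sE -[i'.+2%:R]natr1 => /andP[a b] /andP[c d].
  have : 0 <= sigma (lift ord0 i') * (v ord0 i' - v ord0 i).
    rewrite -(pmulr_lge0 _ (_ : 0 < slope^-1)) ?invr_gt0 //; lra.
  have [le1 le2] := vle i' i (esym e).
  case: (alt.1 (lift ord0 i')) => h; rewrite h.
    by have := le1 h; lra.
  by have := le2 h; lra.
rewrite !ler_norml !ltr_norml.
move=> /andP[a b] /andP[c d] /andP[e f] /andP[g h]; exfalso.
have : i'.+1%:R + 2 <= i.+1%:R :> R by rewrite -natrD ler_nat addn2.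
lra.
Qed.

Lemma lap_cover (y : R) : J y -> exists j : 'I_m.+1, `|y - lap_center j| <= 1.
Proof.
have [m0|m0] := posnP m.
  have mR : m%:R = 0 :> R by rewrite m0.
  rewrite /J /alpha mR !mul0r oppr0 /= in_itv /= => /le_anti <-.
  by exists ord0; rewrite /lap_center mR mulr0 !subr0 normr0.
have /andP[_ am] := alpha_bounds m0.
rewrite J_norm ler_norml => /andP[y1 y2].
suff H k : (k <= m)%N -> y <= 2 * k%:R - m%:R + 1 ->
    exists j : 'I_m.+1, `|y - lap_center j| <= 1
  by apply: (H m (leqnn m)); lra.
elim: k => [|k IH] km h.
  exists ord0; rewrite /lap_center /= !mulr0n in h *.
  by rewrite ler_norml; apply/andP; split; lra.
have [/(IH (ltnW km))//|lt] := leP y (2 * k%:R - m%:R + 1).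
have km' : (k.+1 < m.+1)%N by [].
exists (Ordinal km'); rewrite /lap_center /= ler_norml.
by move: h; rewrite -natr1 => h; apply/andP; split; lra.
Qed.

Lemma stunted_J sigma v (y : R) : alternating_signs sigma ->
  folding_space sigma v -> J y -> J (stunted sigma v y).
Proof.
move=> alt vF Jy; have vJ := vF.1.
rewrite /stunted; case: pickP => [i _|out]; first exact: vJ.
have [j yj] := lap_cover Jy; rewrite (sawtoothE alt yj).
have s1 := slope_gt1; have s0 : 0 < slope by lra.
have aE : (alpha - m%:R) * slope = alpha.
  rewrite /alpha; field; lra.
suff: `|y - lap_center j| * slope <= alpha.
  rewrite J_norm mulrAC 2!normrM (gtr0_norm s0).
  by case: (alt.1 j) => ->; rewrite ?normrN normr1 mul1r.
move: Jy; rewrite J_norm ler_norml => /andP[y1 y2].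
have vb i : - alpha <= v ord0 i <= alpha by have := vJ i; rewrite J_norm ler_norml.
have key (i : 'I_m) t : 1 + sigma (lift ord0 i) * v ord0 i / slope < 1 - t ->
    t * slope <= alpha.
  move=> h; have : t < - (sigma (lift ord0 i) * v ord0 i / slope) by lra.
  rewrite -mulNr ltr_pdivlMr // => {}h; apply: (le_trans (ltW h)).
  have /andP[va vb'] := vb i.
  by case: (alt.1 (lift ord0 i)) => ->; lra.
move: yj; rewrite ler_norml => /andP[yj1 yj2].
have [yc|yc] := leP (lap_center j) y.
  rewrite ger0_norm ?subr_ge0 //.
  have [jm|jm] := ltnP j m.
    apply: (key (Ordinal jm)); have := out (Ordinal jm).
    rewrite /in_plateau /turning_pt /= => /negbT; rewrite -ltNge.
    move: yj1 yj2 yc; rewrite /lap_center -natr1 => yj1 yj2 yc.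
    by rewrite ler0_norm; lra.
  have jE : j = m :> nat by apply/eqP; rewrite eqn_leq jm -ltnS ltn_ord.
  rewrite -[leRHS]aE ler_pM2r // /lap_center jE; lra.
rewrite ltr0_norm ?subr_lt0 //.
case: j yj1 yj2 yc => -[|k] km; rewrite /lap_center /= => yj1 yj2 yc.
  by rewrite -[leRHS]aE ler_pM2r //; lra.
apply: (key (Ordinal (km : (k < m)%N))); have := out (Ordinal (km : (k < m)%N)).
rewrite /in_plateau /turning_pt /= => /negbT; rewrite -ltNge.
by rewrite ger0_norm; lra.
Qed.

End StuntedSawtooth.

(* Main.v *)
(** Call gap the set of points within 1 - alpha / s of a turning point: gaps lie
    inside the plateaus of every stunted map, and S maps the rest of J into J.
    Since S expands, the points whose S-orbit enters a gap are dense in J.  If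
    every folding value is such a point then S_v is hyperbolic, because S_v
    agrees with S until the orbit enters the interior of a plateau; so density
    follows by first pushing v towards the strictly modal vector
    (- sigma_j alpha / 2)_j and then moving each coordinate to a nearby point of
    that kind.  Openness holds because S_v(y) is continuous in (v, y). *)
Require Import Defs.
From mathcomp Require Import all_boot all_order all_algebra.
From mathcomp Require Import all_classical all_reals all_analysis.
From mathcomp Require Import ring lra.
Import Order.TTheory GRing.Theory Num.Theory.
Import numFieldNormedType.Exports.

Set Implicit Arguments.
Unset Strict Implicit.
Unset Printing Implicit Defensive.

Local Open Scope classical_set_scope.
Local Open Scope ring_scope.

Section StuntedDynamics.
Variables (R : realType) (m : nat) (sigma : 'I_m.+1 -> R).
Hypothesis sigma_alt : alternating_signs sigma.

Local Notation s := (slope R m).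
Local Notation a := (alpha R m).
Local Notation S := (sawtooth sigma).
Local Notation left_lap := (widen_ord (leqnSn m)).
Local Notation right_lap := (lift ord0).

(** * Gaps, signs and the geometry of laps *)

Definition gap (y : R) : Prop :=
  exists i : 'I_m, `|y - turning_pt R i| < 1 - a / s.

Definition plateau_interior (v : 'rV[R]_m) (i : 'I_m) (y : R) : bool :=
  `|y - turning_pt R i| < 1 + sigma (right_lap i) * v ord0 i / s.

Lemma slope_gt0 : 0 < s.
Proof. by have := slope_gt1 R m; lra. Qed.

Lemma alpha_div_slope : a / s = a - m%:R.
Proof.
have := slope_gt1 R m; rewrite /alpha => s1; field.
by apply/andP; split; lra.
Qed.

Lemma alpha_lt_slope : (0 < m)%N -> a < s.
Proof. by move=> /(alpha_bounds R)/andP[_]; rewrite /slope; lra. Qed.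

Lemma sigma_sqr j : sigma j * sigma j = 1.
Proof. by case: (sigma_alt.1 j) => ->; rewrite ?mulrNN mulr1. Qed.

Lemma sigma_right_lap (i : 'I_m) : sigma (right_lap i) = - sigma (left_lap i).
Proof.
rewrite (sigma_alt.2 (right_lap i)) (sigma_alt.2 (left_lap i)) lift0 /=.
by rewrite exprS mulN1r mulNr.
Qed.

Lemma normr_sigmaM j (x : R) : `|sigma j * x| = `|x|.
Proof.
by rewrite normrM; case: (sigma_alt.1 j) => ->; rewrite ?normrN normr1 mul1r.
Qed.

Lemma turning_pt_left (i : 'I_m) : turning_pt R i = lap_center R (left_lap i) + 1.
Proof. by rewrite /turning_pt /lap_center /= -natr1; ring. Qed.

Lemma turning_pt_right (i : 'I_m) : turning_pt R i = lap_center R (right_lap i) - 1.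
Proof. by rewrite /turning_pt /lap_center lift0; ring. Qed.

Lemma lap_center_ord0 : lap_center R (ord0 : 'I_m.+1) = - m%:R.
Proof. by rewrite /lap_center /=; ring. Qed.

Lemma lap_center_ord_max : lap_center R (ord_max : 'I_m.+1) = m%:R.
Proof. by rewrite /lap_center /=; ring. Qed.

Lemma lap_right_end (j : 'I_m.+1) : j = ord_max \/ exists i : 'I_m, j = left_lap i.
Proof.
have [jm|jm] := ltnP j m.
  by right; exists (Ordinal jm); apply/val_inj.
by left; apply/val_inj/eqP; rewrite eqn_leq jm -ltnS ltn_ord.
Qed.

Lemma lap_left_end (j : 'I_m.+1) : j = ord0 \/ exists i : 'I_m, j = right_lap i.
Proof. by case: (unliftP ord0 j) => [i ->|->]; [right; exists i|left]. Qed.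

Lemma J_bounds (y : R) : J m y -> - a <= y <= a.
Proof. by rewrite J_norm ler_norml. Qed.

(** * Sawtooth orbits and density of the points that reach a gap *)

Lemma nongap_lap_center_dist (j : 'I_m.+1) (y : R) : J m y ->
  `|y - lap_center R j| <= 1 -> ~ gap y -> `|y - lap_center R j| <= a / s.
Proof.
move=> /J_bounds/andP[y1 y2] yj ng.
have far (i : 'I_m) : 1 - a / s <= `|y - turning_pt R i|.
  by rewrite leNgt; apply/negP => h; apply: ng; exists i.
(* A turning point is at distance 1 from the centre of a lap that it bounds, so avoiding its gap
   leaves [a / s]. At the two outer ends J itself stops at distance [a - m%:R = a / s]. *)
move: yj; rewrite !ler_norml => /andP[yj1 yj2]; apply/andP; split.
  case: (lap_left_end j) => [->|[i ji]].
    by rewrite lap_center_ord0 alpha_div_slope; lra.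
  have := far i; rewrite turning_pt_right -ji ger0_norm; lra.
case: (lap_right_end j) => [->|[i ji]].
  by rewrite lap_center_ord_max alpha_div_slope; lra.
have := far i; rewrite turning_pt_left -ji ler0_norm; lra.
Qed.

Lemma sawtooth_J (y : R) : J m y -> ~ gap y -> J m (S y).
Proof.
move=> Jy ng; have [j yj] := lap_cover Jy.
have := nongap_lap_center_dist Jy yj ng; rewrite J_norm (sawtoothE sigma_alt yj).
rewrite ler_pdivlMr ?slope_gt0 // => h.
by rewrite -mulrA normr_sigmaM normrM (gtr0_norm slope_gt0) mulrC.
Qed.

(* An interval whose iterates under S avoid the gaps would be stretched by the
   factor s > 1 at every step while staying inside J. *)
Lemma gap_preimage_dense (x y : R) : (0 < m)%N -> - a <= x -> x < y -> y <= a ->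
  exists n z, [/\ x <= z <= y & gap (iter n S z)].
Proof.
move=> m0 ax xy ya.
have [N HN] : exists n, 2 * a < (y - x) * s ^+ n.
  exists (Num.bound (2 * a / (y - x))).
  (* [upper_nthrootP] bounds by a power of 2, and [2 <= s] because m is positive. *)
  rewrite -ltr_pdivrMl ?subr_gt0 // mulrC.
  apply: lt_le_trans (upper_nthrootP (leqnn _)) _.
  apply: lerXn2r; rewrite ?nnegrE ?(ltW slope_gt0) //.
  by have : 1 <= m%:R :> R; [rewrite ler1n|rewrite /slope; lra].
elim: N x y ax xy ya HN => [|N IH] x y ax xy ya HN.
  by move: HN; rewrite expr0; lra.
have [[z [zxy gz]]|ng] := pselect (exists z, x <= z <= y /\ gap z).
  by exists 0, z.
have {ng} ng z : x <= z <= y -> ~ gap z by move=> h g; apply: ng; exists z.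
have Jz z : x <= z <= y -> J m z.
  by move=> /andP[z1 z2]; rewrite J_norm ler_norml; apply/andP; split; lra.
have xx : x <= x <= y by rewrite lexx ltW.
have yy : x <= y <= y by rewrite lexx ltW.
have [j] := lap_cover (Jz x xx); rewrite ler_norml => /andP[xj1 xj2].
(* If y lay beyond the lap of x, the turning point between them would be a point of a gap. Hence S
   is affine on the whole interval. *)
have yj : y <= lap_center R j + 1.
  case: (lap_right_end j) => [->|[i ji]].
    by rewrite lap_center_ord_max; have /andP[_] := alpha_bounds R m0; lra.
  rewrite leNgt; apply/negP => yj; apply: (ng (turning_pt R i)).
    by rewrite turning_pt_left -ji; apply/andP; split; lra.
  exists i; rewrite subrr normr0 subr_gt0 ltr_pdivrMr ?slope_gt0 // mul1r.
  exact: alpha_lt_slope.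
have SE z : x <= z <= y -> S z = sigma j * s * (z - lap_center R j).
  move=> /andP[z1 z2]; apply: (sawtoothE sigma_alt).
  by rewrite ler_norml; apply/andP; split; lra.
have s0 := slope_gt0.
have JS z : x <= z <= y -> - a <= S z <= a.
  by move=> h; apply/J_bounds/sawtooth_J; [apply: Jz|apply: ng].
(* Points of the image interval are pulled back by the inverse of the affine branch; min and max
   account for decreasing laps. *)
have pull z' : Num.min (S x) (S y) <= z' <= Num.max (S x) (S y) ->
    exists z, x <= z <= y /\ S z = z'.
  move=> z'b; exists (lap_center R j + sigma j * z' / s).
  have h : x <= lap_center R j + sigma j * z' / s <= y.
    have e : x = lap_center R j + sigma j * S x / s.
      rewrite SE // !mulrA sigma_sqr; field; lra.
    have e' : y = lap_center R j + sigma j * S y / s.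
      rewrite SE // !mulrA sigma_sqr; field; lra.
    rewrite [X in X <= _]e [X in _ <= _ <= X]e' !lerD2l !ler_pM2r ?invr_gt0 //.
    have : sigma j * S x <= sigma j * S y.
      rewrite !SE // !mulrA sigma_sqr !mul1r ler_pM2l //; lra.
    move: z'b; rewrite minElt maxElt.
    by case: (sigma_alt.1 j) => ->; case: ltP => ? /andP[? ?] ?; lra.
  split => //; rewrite SE // [in X in _ * X](addrC (lap_center R j)) addrK.
  by case: (sigma_alt.1 j) => ->; field; lra.
have /andP[Sx1 Sx2] := JS x xx; have /andP[Sy1 Sy2] := JS y yy.
have dist : Num.max (S x) (S y) - Num.min (S x) (S y) = s * (y - x).
  rewrite minElt maxElt !SE //.
  have sxy : 0 < s * (y - x) by apply: mulr_gt0; lra.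
  by case: (sigma_alt.1 j) => ->; case: ltP => ?; lra.
have [] := IH (Num.min (S x) (S y)) (Num.max (S x) (S y)).
- by rewrite minElt; case: ltP.
- by rewrite -subr_gt0 dist mulr_gt0 // subr_gt0.
- by rewrite maxElt; case: ltP.
- by move: HN; rewrite exprS dist mulrA (mulrC s).
move=> n [z' [/pull[z [zxy <-]] g]]; exists n.+1, z; split => //.
by rewrite iterSr.
Qed.

(** * From gap orbits to hyperbolicity, for a fixed folding vector *)

Section FoldingVector.
Variables (v : 'rV[R]_m) (vF : folding_space sigma v).

Lemma folding_div_slope (j : 'I_m.+1) (i : 'I_m) :
  `|sigma j * v ord0 i / s| <= a / s.
Proof.
rewrite normrM normr_sigmaM (gtr0_norm (_ : 0 < s^-1)) ?invr_gt0 ?slope_gt0 //.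
by rewrite ler_pM2r ?invr_gt0 ?slope_gt0 // -J_norm; apply: vF.1.
Qed.

(** The radius is at most [1 + a / s = 1 + a - m%:R] and turning points have modulus at most
    [m%:R - 1], so the open interval stays within J and is not cut by it. *)
Lemma plateau_interiorE (i : 'I_m) (y : R) :
  (plateau sigma v i)° y <-> plateau_interior v i y.
Proof.
rewrite /plateau_interior; set c := turning_pt R i; set r := _ + _ / _.
split=> [/nbhs_ballP[e /= e0 sub]|yc].
  rewrite ltNge; apply/negP => ry.
  have [cy|yc] := leP c y.
    have /sub[_] : ball y e (y + e / 2).
      by rewrite /ball /= ltr_norml; apply/andP; split; lra.
    rewrite /in_plateau -/c -/r ger0_norm; last lra.
    by move: ry; rewrite ger0_norm; lra.
  have /sub[_] : ball y e (y - e / 2).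
    by rewrite /ball /= ltr_norml; apply/andP; split; lra.
  rewrite /in_plateau -/c -/r ler0_norm; last lra.
  by move: ry; rewrite ler0_norm; lra.
apply/nbhs_ballP; exists (r - `|y - c|) => /=; first by rewrite subr_gt0.
move=> z; rewrite /ball /= distrC => zy.
have zc : `|z - c| < r.
  have := ler_normD (z - y) (y - c); rewrite subrKA.
  by move=> h; apply: le_lt_trans h _; lra.
split; last by rewrite /in_plateau -/c -/r ltW.
have := folding_div_slope (right_lap i) i.
rewrite alpha_div_slope J_norm !ler_norml => /andP[_ ra].
move: zc; rewrite ltr_norml => /andP[z1 z2].
have i1 : 1 <= i.+1%:R :> R by rewrite ler1n.
have i2 : i.+1%:R <= m%:R :> R by rewrite ler_nat.
by move: z1 z2; rewrite /r /c /turning_pt => z1 z2; apply/andP; split; lra.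
Qed.

Lemma gap_plateau_interior (y : R) : gap y -> exists i, plateau_interior v i y.
Proof.
move=> [i yi]; exists i; rewrite /plateau_interior; apply: lt_le_trans yi _.
by have := folding_div_slope (right_lap i) i; rewrite ler_norml => /andP[+ _]; lra.
Qed.

(** The case to check is an endpoint of a plateau: the radius is such that S already has the height
    of the plateau there. *)
Lemma stunted_sawtooth (y : R) : (forall i, ~ plateau_interior v i y) ->
  stunted sigma v y = S y.
Proof.
move=> out; rewrite /stunted; case: pickP => // i.
have := out i; rewrite /in_plateau /plateau_interior.
set t := _ * _ / _ => /negP; rewrite -leNgt => ge le.
have s0 := slope_gt0.
have vE : v ord0 i = sigma (right_lap i) * s * t.
  by rewrite /t; case: (sigma_alt.1 (right_lap i)) => ->; field; lra.
(* The endpoint is at distance [1 + t] from the turning point, hence [|t|] from the centre of the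
   adjacent lap; the bound places it in that lap. *)
have : `|t| <= 1.
  apply: le_trans (folding_div_slope _ _) _.
  by rewrite ler_pdivrMr // mul1r ltW // alpha_lt_slope //
    (leq_ltn_trans _ (ltn_ord i)).
rewrite ler_norml => /andP[t1 t2].
have {ge le} yE : `|y - turning_pt R i| = 1 + t by apply: le_anti; rewrite ge le.
have [cy|yc] := leP (turning_pt R i) y.
  have cE := turning_pt_right i.
  move: yE; rewrite ger0_norm ?subr_ge0 // => yE.
  rewrite (@sawtoothE _ _ _ (right_lap i) _ sigma_alt) => [|].
    rewrite vE; congr (_ * _); lra.
  by rewrite ler_norml; apply/andP; split; lra.
have cE := turning_pt_left i.
move: yE; rewrite ltr0_norm ?subr_lt0 // => yE.
rewrite (@sawtoothE _ _ _ (left_lap i) _ sigma_alt) => [|].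
  rewrite vE sigma_right_lap !mulNr -mulrN; congr (_ * _); lra.
by rewrite ler_norml; apply/andP; split; lra.
Qed.

(* As long as the orbit of y under S has not entered the interior of a plateau,
   it coincides with the orbit under the stunted map, even when it passes
   through endpoints of plateaus. *)
Lemma gap_orbit_plateau (n : nat) (y : R) : J m y -> gap (iter n S y) ->
  exists k i, plateau_interior v i (iter k (stunted sigma v) y).
Proof.
elim: n y => [|n IH] y Jy; first by move=> /gap_plateau_interior[i]; exists 0, i.
have [[i yi]|out] := pselect (exists i, plateau_interior v i y).
  by exists 0, i.
have {}out i : ~ plateau_interior v i y by move=> yi; apply: out; exists i.
rewrite iterSr -(stunted_sawtooth out).
by move=> /(IH _ (stunted_J sigma_alt vF Jy))[k [i]]; exists k.+1, i; rewrite iterSr.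
Qed.

Lemma gap_orbits_hyperbolic : (forall i, exists n, gap (iter n S (v ord0 i))) ->
  hyperbolic sigma v.
Proof.
move=> h i; have [n /gap_orbit_plateau[|k [j kj]]] := h i; first exact: vF.1.
by exists k, j; apply/plateau_interiorE.
Qed.

End FoldingVector.

(** * Folding values extended to the ends of J *)

(* The folding values v_1, ..., v_m completed by the values - sigma_0 alpha and
   sigma_m alpha taken at the two ends of J. *)
Definition folding_ext (v : 'rV[R]_m) (j : nat) : R :=
  if j is i.+1 then
    if insub i is Some i' then v ord0 (i' : 'I_m) else sigma ord_max * a
  else - (sigma ord0 * a).

Lemma folding_ext_left_lap (v : 'rV[R]_m) (i : 'I_m) :
  folding_ext v (left_lap i).+1 = v ord0 i.
Proof. by rewrite /folding_ext /= valK. Qed.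

Lemma folding_ext_right_lap (v : 'rV[R]_m) (i : 'I_m) :
  folding_ext v (right_lap i) = v ord0 i.
Proof. by rewrite lift0 -folding_ext_left_lap. Qed.

Lemma sigma_ext_ord0 (v : 'rV[R]_m) : sigma ord0 * folding_ext v (ord0 : 'I_m.+1) = - a.
Proof. by rewrite /= mulrN mulrA sigma_sqr mul1r. Qed.

Lemma sigma_ext_ord_max (v : 'rV[R]_m) :
  sigma ord_max * folding_ext v (ord_max : 'I_m.+1).+1 = a.
Proof. by rewrite /folding_ext /= insubF ?ltnn // mulrA sigma_sqr mul1r. Qed.

Lemma alpha_ge0 : 0 <= a.
Proof.
have s1 := slope_gt1 R m.
apply: divr_ge0; last lra.
by apply: mulr_ge0; [exact: ler0n|lra].
Qed.

Lemma sigma_ext_bounds (v : 'rV[R]_m) (j : 'I_m.+1) (n : nat) :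
  (forall i : 'I_m, J m (v ord0 i)) -> - a <= sigma j * folding_ext v n <= a.
Proof.
move=> vJ; rewrite -ler_norml normr_sigmaM.
have a0 : `|a| <= a by rewrite ger0_norm ?alpha_ge0.
case: n => [|n] /=; first by rewrite normrN normr_sigmaM.
case: insubP => [i _ _|_]; first by rewrite -J_norm.
by rewrite normr_sigmaM.
Qed.

(** Multiplying by the sign merges the two monotonicity cases. The inequalities on the outer laps
    come for free, since the signed end values are the extremes [- a] and [a]. *)
Lemma folding_spaceP (v : 'rV[R]_m) : folding_space sigma v <->
  (forall i : 'I_m, J m (v ord0 i)) /\
  (forall j : 'I_m.+1, sigma j * folding_ext v j <= sigma j * folding_ext v j.+1).
Proof.
split=> [[vJ vle]|[vJ vle]]; split=> //.
  move=> j; case: (lap_left_end j) => [->|[i ji]].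
    rewrite sigma_ext_ord0.
    by have /andP[] := sigma_ext_bounds ord0 (ord0 : 'I_m.+1).+1 vJ.
  case: (lap_right_end j) => [->|[i' ji']].
    rewrite sigma_ext_ord_max.
    by have /andP[] := sigma_ext_bounds ord_max (ord_max : 'I_m.+1) vJ.
  have ii' : i' = i.+1 :> nat by rewrite -[RHS]lift0 -ji ji'.
  have [h1 h2] := vle i i' ii'.
  rewrite [in X in X <= _]ji folding_ext_right_lap.
  rewrite [in X in _ <= X]ji' folding_ext_left_lap -ji' ji.
  by case: (sigma_alt.1 (right_lap i)) => e; move: h1 h2; rewrite e; lra.
move=> i i' ii'.
have ji' : right_lap i = left_lap i' by apply/val_inj; rewrite /= ii'.
have := vle (right_lap i); rewrite folding_ext_right_lap.
rewrite [X in folding_ext v X.+1](congr1 val ji') folding_ext_left_lap.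
by move=> h; split=> e; move: h; rewrite e; lra.
Qed.

(** * A closed formula for the stunted map *)

Definition clamp (lo hi x : R) : R := Num.min (Num.max x lo) hi.

(** On lap j the map [sigma j * S] increases with slope s; the neighbouring plateaus cut it off at
    the signed folding values. *)
Definition lap_clamp (v : 'rV[R]_m) (j : 'I_m.+1) (y : R) : R :=
  clamp (sigma j * folding_ext v j) (sigma j * folding_ext v j.+1)
    (s * (y - lap_center R j)).

(* On lap j the stunted map is sigma_j * lap_clamp v j; a single formula, valid
   on all of J, is obtained by adding up the increments over the laps. *)
Definition stunted_formula (v : 'rV[R]_m) (y : R) : R :=
  - (sigma ord0 * a) +
  \sum_(j < m.+1) sigma j * (lap_clamp v j y - sigma j * folding_ext v j).

Lemma clamp_lo (lo hi x : R) : lo <= hi -> x <= lo -> clamp lo hi x = lo.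
Proof. by move=> h1 h2; rewrite /clamp max_r // min_l. Qed.

Lemma clamp_hi (lo hi x : R) : lo <= hi -> hi <= x -> clamp lo hi x = hi.
Proof. by move=> h1 h2; rewrite /clamp max_l ?min_r // (le_trans h1). Qed.

Lemma clamp_id (lo hi x : R) : lo <= x -> x <= hi -> clamp lo hi x = x.
Proof. by move=> h1 h2; rewrite /clamp max_l // min_l. Qed.

Lemma J_alpha : J m a /\ J m (- a).
Proof. by rewrite !J_norm normrN ger0_norm ?alpha_ge0. Qed.

Section StuntedFormula.
Hypothesis m_gt0 : (0 < m)%N.
Variables (v : 'rV[R]_m) (vF : folding_space sigma v).

Lemma stunted_lap (j : 'I_m.+1) (y : R) : J m y -> `|y - lap_center R j| <= 1 ->
  stunted sigma v y = sigma j * lap_clamp v j y.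
Proof.
move=> Jy yj; have [vJ /(_ j) mono] := (folding_spaceP v).1 vF.
have s0 := slope_gt0; have /andP[y1 y2] := J_bounds Jy.
have := yj; rewrite ler_norml => /andP[yj1 yj2].
have asm : s * (a - m%:R) = a by rewrite -alpha_div_slope; field; lra.
have right_end i : j = right_lap i ->
    in_plateau sigma v i y = (s * (y - lap_center R j) <= sigma j * folding_ext v j).
  move=> ji; rewrite [in X in _ = (_ <= X)]ji folding_ext_right_lap.
  rewrite /in_plateau turning_pt_right -ji ger0_norm; last lra.
  by rewrite -ler_pdivlMl //; apply/idP/idP => ?; lra.
have left_end i : j = left_lap i ->
    in_plateau sigma v i y = (sigma j * folding_ext v j.+1 <= s * (y - lap_center R j)).
  move=> ji; rewrite [in X in _ = (X <= _)]ji folding_ext_left_lap.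
  rewrite /in_plateau turning_pt_left sigma_right_lap -ji ler0_norm; last lra.
  by rewrite -ler_pdivrMl //; apply/idP/idP => ?; lra.
rewrite /stunted; case: pickP => [i iy|out].
  (* Radii below 2 allow only the plateaus at the two ends of lap j to reach y; the far cases are
     contradictory. *)
  have rad : `|y - turning_pt R i| < 2.
    apply: le_lt_trans iy _; have := folding_div_slope vF (right_lap i) i.
    have as1 : a / s < 1 by rewrite ltr_pdivrMr // mul1r alpha_lt_slope.
    by rewrite ler_norml => /andP[_]; lra.
  move: rad; rewrite ltr_norml => /andP[r1 r2].
  have [ij|ji|ij] := ltngtP i.+1 j.
  - exfalso; move: yj1 r2; rewrite /lap_center /turning_pt.
    have : i.+1%:R + 1 <= j%:R :> R by rewrite natr1 ler_nat.
    by lra.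
  - have [jE|jE] := eqVneq j (left_lap i).
      rewrite /lap_clamp clamp_hi //; last by rewrite -(left_end i).
      rewrite mulrA sigma_sqr mul1r.
      by rewrite [in RHS]jE folding_ext_left_lap.
    exfalso; move: yj2 r1; rewrite /lap_center /turning_pt -natr1.
    have : j%:R + 1 <= i%:R :> R.
      rewrite natr1 ler_nat ltn_neqAle -ltnS ji andbT.
      by apply: contra jE => /eqP e; apply/eqP/val_inj.
    by lra.
  - have ji : j = right_lap i by apply/ord_inj; rewrite lift0.
    rewrite /lap_clamp clamp_lo //; last by rewrite -(right_end i).
    rewrite mulrA sigma_sqr mul1r.
    by rewrite ji folding_ext_right_lap.
rewrite (sawtoothE sigma_alt yj) /lap_clamp clamp_id ?mulrA //.
  (* Off the plateaus the clamp is inactive. At the outer ends of the first and last laps the bounds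
     come from J, through [s * (a - m%:R) = a]. *)
  case: (lap_left_end j) => [->|[i ji]].
    rewrite sigma_ext_ord0 lap_center_ord0; nra.
  by have := out i; rewrite (right_end i) // => /negbT; rewrite -ltNge => /ltW.
case: (lap_right_end j) => [->|[i ji]].
  rewrite sigma_ext_ord_max lap_center_ord_max; nra.
by have := out i; rewrite (left_end i) // => /negbT; rewrite -ltNge => /ltW.
Qed.

(** At distance 1 or more from the centre of a lap, the linear function has modulus at least [s > a]
    and the clamp saturates: laps left of y add their full increment, laps right of it add 0. *)
Lemma stunted_formulaE (y : R) : J m y -> stunted sigma v y = stunted_formula v y.
Proof.
move=> Jy; have [k yk] := lap_cover Jy; rewrite (stunted_lap Jy yk).
have [vJ mono] := (folding_spaceP v).1 vF.
(* The partial sums: extended folding values up to the lap k of y, constantly the value at y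
   afterwards. *)
pose g n := if (n <= k)%N then folding_ext v n else sigma k * lap_clamp v k y.
rewrite /stunted_formula (eq_bigr (fun j : 'I_m.+1 => g j.+1 - g j)).
  rewrite -(big_mkord xpredT (fun j => g j.+1 - g j)) telescope_sumr //.
  by rewrite /g leq0n /= leqNgt ltn_ord /= [RHS]addrC subrK.
move=> j _; rewrite /g mulrBr mulrA sigma_sqr mul1r.
have s0 := slope_gt0; have as1 := alpha_lt_slope m_gt0.
have /andP[l1 l2] := sigma_ext_bounds j j vJ.
have /andP[h1 h2] := sigma_ext_bounds j j.+1 vJ.
move: yk; rewrite ler_norml => /andP[yk1 yk2].
have [jk|kj|jk] := ltngtP j k.
- have : 1 <= y - lap_center R j.
    have : j%:R + 1 <= k%:R :> R by rewrite natr1 ler_nat.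
    by move: yk1; rewrite /lap_center; lra.
  rewrite -(ler_pM2l s0) mulr1 => h.
  by rewrite /lap_clamp clamp_hi // ?mulrA ?sigma_sqr ?mul1r //; lra.
- have : y - lap_center R j <= -1.
    have : k%:R + 1 <= j%:R :> R by rewrite natr1 ler_nat.
    by move: yk2; rewrite /lap_center; lra.
  rewrite -(ler_pM2l s0) mulrN1 => h; rewrite subrr.
  by rewrite /lap_clamp clamp_lo // ?mulrA ?sigma_sqr ?mul1r ?subrr //; lra.
- by move/val_inj: jk => ->.
Qed.

(** The end values are the same for all v: since [s * (a - m%:R) = a], the outer laps reach their
    extreme bounds exactly at the ends of J. *)
Lemma extended_foldingE (n : nat) : extended_folding sigma v n = folding_ext v n.
Proof.
have [_ mono] := (folding_spaceP v).1 vF.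
have asm : s * (a - m%:R) = a.
  by rewrite -alpha_div_slope; field; have := slope_gt0; lra.
have /andP[am1 am2] := alpha_bounds R m_gt0; have [Ja JNa] := J_alpha.
case: n => [|n] /=.
  rewrite (@stunted_lap ord0) //; last first.
    by rewrite lap_center_ord0 ler_norml; apply/andP; split; lra.
  rewrite /lap_clamp sigma_ext_ord0 clamp_lo ?mulrN //.
    by rewrite -(sigma_ext_ord0 v).
  by rewrite lap_center_ord0; lra.
case: insubP => // _.
rewrite (@stunted_lap ord_max) //; last first.
  by rewrite lap_center_ord_max ler_norml; apply/andP; split; lra.
rewrite /lap_clamp sigma_ext_ord_max clamp_hi //.
  by rewrite -[leRHS](sigma_ext_ord_max v).
by rewrite lap_center_ord_max; lra.
Qed.

End StuntedFormula.

(** * Continuity in the folding vector *)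

Lemma folding_ext_continuous (n : nat) : continuous (fun v => folding_ext v n).
Proof.
case: n => [|n] v /=; first exact: cst_continuous.
by case: insubP => [i _ _|_]; [exact: coord_continuous|exact: cst_continuous].
Qed.

Lemma lap_clamp_continuous (j : 'I_m.+1) (g : 'rV[R]_m -> R) : continuous g ->
  continuous (fun v => lap_clamp v j (g v)).
Proof.
move=> gc v; rewrite /lap_clamp /clamp.
have c n : {for v, continuous (fun v => sigma j * folding_ext v n : R^o)}.
  by apply: continuousM; [exact: cst_continuous|exact: folding_ext_continuous].
apply: (@continuous_min _ _ (fun v => Num.max _ _ : R^o) _ _ _ (c j.+1)).
apply: (@continuous_max _ _ (fun v => _ : R^o) _ _ _ (c j)).
apply: continuousM; first exact: cst_continuous.
by apply: continuousB; [exact: gc|exact: cst_continuous].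
Qed.

Lemma stunted_formula_continuous (g : 'rV[R]_m -> R) : continuous g ->
  continuous (fun v => stunted_formula v (g v)).
Proof.
move=> gc v; rewrite /stunted_formula.
have sum_continuous : continuous (fun w => \sum_(j < m.+1)
    sigma j * (lap_clamp w j (g w) - sigma j * folding_ext w j) : R^o).
  apply: (@continuous_big R^o _ _ _ _ add_continuous) => j _ {}v.
  rewrite -[continuous_at _ _]/({for v, continuous (fun w : 'rV[R]_m =>
    sigma j * (lap_clamp w j (g w) - sigma j * folding_ext w j) : R)}).
  apply: continuousM; first exact: cst_continuous.
  apply: continuousB; first exact: lap_clamp_continuous.
  by apply: continuousM; [exact: cst_continuous|exact: folding_ext_continuous].
by apply: (@continuousD _ R^o _ (fun=> _) (fun w => \sum_(j < m.+1) _));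
  [exact: cst_continuous|exact: sum_continuous].
Qed.

Lemma iter_formula_continuous (k : nat) (i : 'I_m) :
  continuous (fun v => iter k (stunted_formula v) (v ord0 i)).
Proof.
elim: k => [|k IH]; first exact: coord_continuous.
exact: stunted_formula_continuous.
Qed.

(** * Openness *)

Lemma continuous_pos_near (f : 'rV[R]_m -> R) (v : 'rV[R]_m) : {for v, continuous f} ->
  0 < f v -> \forall w \near v, 0 < f w.
Proof. by move=> fc fv; exact: (cvgr_gt _ fc _ fv). Qed.

(** Written with formulas continuous on all of ['rV[R]_m], so that openness can be shown in the
    ambient space and then restricted to [folding_space]. *)
Definition good_set : set 'rV[R]_m :=
  [set v | (forall j : 'I_m.+1, 0 < sigma j * (folding_ext v j.+1 - folding_ext v j)) /\
    forall i : 'I_m, exists k j,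
      plateau_interior v j (iter k (stunted_formula v) (v ord0 i))].

Lemma good_setE (v : 'rV[R]_m) : (0 < m)%N -> folding_space sigma v ->
  (strictly_modal sigma v /\ hyperbolic sigma v) = good_set v.
Proof.
move=> m0 vF; have itE i k :
    iter k (stunted sigma v) (v ord0 i) = iter k (stunted_formula v) (v ord0 i)
    /\ J m (iter k (stunted sigma v) (v ord0 i)).
  elim: k => [|k [IH Jk]] /=; first by split=> //; exact: vF.1.
  by rewrite -IH -stunted_formulaE //; split=> //; exact: stunted_J.
apply/propext; split=> -[sm hyp]; split.
- by move=> j; have := sm j; rewrite !extended_foldingE.
- move=> i; have [k [j /(plateau_interiorE vF)]] := hyp i.
  by rewrite (itE i k).1; exists k, j.
- by move=> j; rewrite !extended_foldingE.
- move=> i; have [k [j]] := hyp i; rewrite -(itE i k).1 => h.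
  by exists k, j; apply/(plateau_interiorE vF).
Qed.

Lemma open_good_set : open good_set.
Proof.
rewrite openE => v [sm hyp]; rewrite /interior /= /good_set.
apply: filterI.
  apply: (@filter_forall _ _ _ _ (nbhs_filter v)) => j.
  apply: continuous_pos_near (sm j).
  apply: continuousM; first exact: cst_continuous.
  by apply: continuousB; exact: folding_ext_continuous.
apply: (@filter_forall _ _ _ _ (nbhs_filter v)) => i; have [k [j vj]] := hyp i.
(* The time k and the plateau j found for v are kept for all nearby w; positivity of [f] says that w
   still enters that plateau. *)
pose f (w : 'rV[R]_m) := 1 + sigma (right_lap j) * w ord0 j / s -
  `|iter k (stunted_formula w) (w ord0 i) - turning_pt R j|.
have : \forall w \near v, 0 < f w.
  apply: continuous_pos_near; last by rewrite subr_gt0.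
  apply: continuousB; last first.
    pose g (w : 'rV[R]_m) : R :=
      iter k (stunted_formula w) (w ord0 i) - turning_pt R j.
    apply: (@continuous_comp _ R R g (fun y => `|y|)); last exact: norm_continuous.
    by apply: continuousB; [exact: iter_formula_continuous|exact: cst_continuous].
  apply: continuousD; first exact: cst_continuous.
  apply: continuousM; last exact: cst_continuous.
  by apply: continuousM; [exact: cst_continuous|exact: coord_continuous].
by apply: filterS => w; rewrite subr_gt0 => h; exists k, j.
Qed.

(** * Density *)

Lemma near_good_set (v : 'rV[R]_m) (e : R) : (0 < m)%N -> 0 < e ->
  folding_space sigma v ->
  exists w, [/\ folding_space sigma w, strictly_modal sigma w,
    hyperbolic sigma w & ball v e w].
Proof.
move=> m0 e0 vF; have [vJ mono] := (folding_spaceP v).1 vF.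
have /andP[ma _] := alpha_bounds R m0.
have a0 : 0 < a by apply: le_lt_trans ma; rewrite ler0n.
have a2 : 0 < a * 2 by lra.
(* A coordinate moves by at most [t * a] towards 0, [t * a / 2] towards the target and [t * a / 5]
   to a gap preimage, in total less than [2 * t * a]. *)
have [t [t0 t1 te]] : exists t : R, [/\ 0 < t, t <= 1 & t * a * 2 <= e].
  exists (Num.min 1 (e / (a * 2))); split.
  - by rewrite lt_min ltr01 divr_gt0.
  - by rewrite ge_min lexx.
  - by rewrite -mulrA -ler_pdivlMr // ge_min lexx orbT.
have ta0 : 0 < t * a by rewrite mulr_gt0.
(* For the target vector the signed values at the two ends of every lap are at most [- a / 2] and at
   least [a / 2]. This leaves a margin [t * a / 2] on each side, also from the ends of J. *)
pose u i := (1 - t) * v ord0 i - t * sigma (right_lap i) * a / 2.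
have vb i : - a <= v ord0 i <= a := J_bounds (vJ i).
have ub i : - a + t * a / 5 <= u i /\ u i <= a - t * a / 5.
  rewrite /u; have /andP[v1 v2] := vb i.
  have : 0 <= (1 - t) * (v ord0 i + a) by apply: mulr_ge0; lra.
  have : 0 <= (1 - t) * (a - v ord0 i) by apply: mulr_ge0; lra.
  by case: (sigma_alt.1 (right_lap i)) => ->; split; lra.
have wit i : exists z, (u i - t * a / 5 <= z <= u i + t * a / 5) /\
    exists n, gap (iter n S z).
  have [u1 u2] := ub i.
  have [||| n [z [zb g]]] := @gap_preimage_dense (u i - t * a / 5) (u i + t * a / 5) m0;
    try lra.
  by exists z; split => //; exists n.
have [z zP] := choice wit.
pose w : 'rV[R]_m := \row_i z i.
have wE i : w ord0 i = z i by rewrite mxE.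
have wJ i : J m (w ord0 i).
  have [/andP[z1 z2] _] := zP i; have [u1 u2] := ub i.
  by rewrite wE J_norm ler_norml; apply/andP; split; lra.
(* Here [3 / 10 = 1 / 2 - 1 / 5]: the margin won by the push, less the move from [u] to [z]. *)
have lo (j : 'I_m.+1) : sigma j * folding_ext w j <=
    (1 - t) * (sigma j * folding_ext v j) - t * a * (3 / 10).
  case: (lap_left_end j) => [->|[i ->]]; first by rewrite !sigma_ext_ord0; lra.
  rewrite !folding_ext_right_lap wE; have [] := zP i; rewrite /u.
  by case: (sigma_alt.1 (right_lap i)) => -> /andP[? ?] _; lra.
have hi (j : 'I_m.+1) : sigma j * folding_ext w j.+1 >=
    (1 - t) * (sigma j * folding_ext v j.+1) + t * a * (3 / 10).
  case: (lap_right_end j) => [->|[i ->]]; first by rewrite !sigma_ext_ord_max; lra.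
  rewrite !folding_ext_left_lap wE; have [] := zP i; rewrite /u sigma_right_lap.
  by case: (sigma_alt.1 (left_lap i)) => -> /andP[? ?] _; lra.
have strict (j : 'I_m.+1) :
    sigma j * folding_ext w j < sigma j * folding_ext w j.+1.
  have := lo j; have := hi j.
  have : 0 <= (1 - t) * (sigma j * folding_ext v j.+1 - sigma j * folding_ext v j).
    by apply: mulr_ge0; rewrite subr_ge0.
  by rewrite mulrBr; lra.
have wF : folding_space sigma w by apply/folding_spaceP; split=> // j; apply/ltW.
exists w; split=> //.
- by move=> j; rewrite !extended_foldingE // mulrBr subr_gt0.
- by apply: gap_orbits_hyperbolic => // i; rewrite wE; have [] := zP i.
- split=> // i j; rewrite ord1 /ball /= wE.
  have [/andP[z1 z2] _] := zP j; have /andP[v1 v2] := vb j.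
  have tv1 : 0 <= t * (v ord0 j + a) by apply: mulr_ge0; lra.
  have tv2 : 0 <= t * (a - v ord0 j) by apply: mulr_ge0; lra.
  move: z1 z2; rewrite ltr_norml /u.
  by case: (sigma_alt.1 (right_lap j)) => -> z1 z2; apply/andP; split; lra.
Qed.

End StuntedDynamics.

Theorem lemma5p9 (R : realType) (m : nat) (m_ge1 : (1 <= m)%N)
    (sigma : 'I_m.+1 -> R) (sigma_alt : alternating_signs sigma) :
  let good : set (folding_space sigma) :=
    [set v | strictly_modal sigma (set_val v) /\ hyperbolic sigma (set_val v)] in
  open good /\ dense good.
Proof.
split.
  (* Open sets of the subspace are preimages under [set_val] of open sets of ['rV[R]_m]. *)
  exists (good_set sigma); first exact: open_good_set.
  by apply/funext => v; rewrite /preimage /= (good_setE sigma_alt) //; exact: set_valP.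
move=> O [v Ov] [U oU UO]; subst O.
have /nbhs_ballP[e /= e0 eU] : nbhs (set_val v) U by apply: open_nbhs_nbhs.
have [w [wF wm wh vw]] := near_good_set sigma_alt m_ge1 e0 (set_valP v).
by exists (SigSub (mem_set wF)); split; [apply: eU|split].
Qed.
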